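(* Let $N\geq 1$ be an integer, let $k$ be a positive integer and let $s$ be an integer in the range $1\leq s\leq k$. Let $r$ be an integer with $$r\geq s(k+1)^{N-1}+(k+1-s)k^{N-1}.$$ Then $$\widehat{\alpha}(\mathbb{P}^N;r)\geq k+\frac{s}{k+1}.$$
   Context: The base field is $\mathbb{C}$. For a non-empty finite set of points $Z\subset\mathbb{P}^N$ with saturated (radical) homogeneous ideal $I\subset\mathbb{C}[x_0,\ldots,x_N]$, let $I^{(m)}=\bigcap_{P\in Z}I(P)^m$ be the $m$-th symbolic power (generated by forms vanishing to order at least $m$ at every point of $Z$), and for a non-zero proper homogeneous ideal $J$ let $\alpha(\mathbb{P}^N;J)=\min\{d:J_d\neq 0\}$. The Waldschmidt constant of $I$ is $\widehat{\alpha}(\mathbb{P}^N;I)=\inf_{m\geq 1}\alpha(\mathbb{P}^N;I^{(m)})/m$. For a positive integer $r$, $\widehat{\alpha}(\mathbb{P}^N;r)$ denotes the Waldschmidt constant $\widehat{\alpha}(\mathbb{P}^N;I)$ of the radical ideal $I$ of a set of $r$ very general points in $\mathbb{P}^N$; ''very general'' means that the $r$-tuple of points lies outside a suitable countable union of proper closed subvarieties of $(\mathbb{P}^N)^r$ (the value is then independent of the choice of points). *)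

(* Defs.v *)
From HB Require Import structures.
From mathcomp Require Import all_boot all_order all_algebra.
From mathcomp Require Import boolp classical_sets reals.
From mathcomp Require Import complex mpoly.

Set Implicit Arguments.
Unset Strict Implicit.
Unset Printing Implicit Defensive.

Import Order.TTheory GRing.Theory Num.Theory.

Local Open Scope classical_set_scope.
Local Open Scope ring_scope.

(* Points of P^N(K) are the lines through the origin of K^(N+1). *)
Definition proj (K : fieldType) (N : nat) : Type :=
  {L : {vspace 'rV[K]_N.+1} | \dim L == 1%N}.

Definition line (K : fieldType) (N : nat) (P : proj K N) :
    {vspace 'rV[K]_N.+1} := sval P.

(* The vectors of [line P], other than 0, are the homogeneous
   coordinates of P.  Over an infinite field a polynomial vanishing on the
   whole line is one all of whose homogeneous components vanish at P, so this
   is the homogeneous ideal I(P). *)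
Definition point_ideal (K : fieldType) (N : nat) (P : proj K N) :
    set {mpoly K[N.+1]} :=
  [set f | forall v : 'rV[K]_N.+1, v \in line P -> f.@[v 0] = 0].

Definition ideal_power (A : comNzRingType) (J : set A) (m : nat) : set A :=
  [set f | exists (n : nat) (g : 'I_n -> A) (h : 'I_n -> 'I_m -> A),
     (forall i j, J (h i j)) /\ f = \sum_(i < n) g i * \prod_(j < m) h i j].

Definition symbolic_power (K : fieldType) (N : nat) (Z : set (proj K N))
    (m : nat) : set {mpoly K[N.+1]} :=
  \bigcap_(P in Z) ideal_power (point_ideal P) m.

Definition has_form (K : fieldType) (n : nat) (J : set {mpoly K[n]})
    (d : nat) : Prop :=
  exists f : {mpoly K[n]}, [/\ J f, f \is d.-homog & f != 0].

(* min {d | J_d <> 0}, with the junk value 0 when J contains no nonzero form. *)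
Definition alpha (K : fieldType) (n : nat) (J : set {mpoly K[n]}) : nat :=
  xget 0%N [set d | has_form J d /\ forall e, has_form J e -> (d <= e)%N].

Definition waldschmidt (R : realType) (N : nat) (Z : set (proj R[i] N)) : R :=
  inf [set (alpha (symbolic_power Z m))%:R / m%:R | m in [set m | (0 < m)%N]].

(* Polynomials on (K^(N+1))^r: the j-th coordinate of the i-th factor is the
   variable of index [mxvec_index i j]. *)
Definition multihomogeneous (K : fieldType) (r N : nat)
    (f : {mpoly K[r * N.+1]}) : Prop :=
  exists d : 'I_r -> nat, forall m : 'X_{1..r * N.+1}, m \in msupp f ->
    forall i : 'I_r, (\sum_(j < N.+1) m (mxvec_index i j))%N = d i.

Definition zero_locus (K : fieldType) (r N : nat)
    (S : set {mpoly K[r * N.+1]}) : set ('I_r -> proj K N) :=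
  [set P | forall f, S f -> forall v : 'M[K]_(r, N.+1),
     (forall i, row i v \in line (P i)) -> f.@[mxvec v 0] = 0].

Definition zariski_closed (K : fieldType) (r N : nat)
    (V : set ('I_r -> proj K N)) : Prop :=
  exists2 S : set {mpoly K[r * N.+1]},
    (forall f, S f -> multihomogeneous f) & V = zero_locus S.

Definition very_generally (K : fieldType) (r N : nat)
    (Q : ('I_r -> proj K N) -> Prop) : Prop :=
  exists2 V : nat -> set ('I_r -> proj K N),
    (forall n, zariski_closed (V n) /\ V n <> setT)
    & (forall P, ~ (\bigcup_n V n) P -> Q P).

(* The Waldschmidt constant of r very general points.  For N >= 1 the diagonals
   are proper closed subsets of (P^N)^r, so the points of a very general tuple
   may be taken pairwise distinct.  The common value is unique, as C is
   uncountable. *)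
Definition waldschmidt_very_general (R : realType) (N r : nat) : R :=
  xget 0 [set a : R | very_generally
    (fun P : 'I_r -> proj R[i] N => waldschmidt (range P) = a)].

(* Main.v *)
From HB Require Import structures.
Require Import Defs.
From mathcomp Require Import all_boot all_order all_algebra.
From mathcomp Require Import boolp classical_sets reals.
From mathcomp Require Import complex mpoly.
From mathcomp Require Import ring lra zify.

(** The Waldschmidt constant of [r] very general points is computed by
    comparison with one special configuration.

    For fixed [m] and [d], the tuples of points through which some nonzero form
    of degree [d] passes with multiplicity [m] form a Zariski closed subset of
    the product of projective spaces ([has_form_closed]): the form exists
    exactly when a matrix, whose entries are multihomogeneous in the coordinates
    of the points, has a nonzero kernel, and this is the vanishing of its maximal
    minors.  Off the countably many such subsets that are proper, the set of the
    degrees [d] that occur for a given [m] does not depend on the tuple, and is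
    contained in the one of any particular tuple.  This gives both the
    existence of the constant ([very_generally_waldschmidt]) and the bound, once
    a tuple is found for which multiplicity [m] forces [d >= m (k + s / (k + 1))].
    Countably many proper closed subsets do not cover the product
    ([very_general_point]) because the field is uncountable.

    The special configuration lies, in affine coordinates, on the [k + 1]
    parallel hyperplanes [x_N = 0, ..., k]; the first [s] contain a grid of
    [(k + 1)^(N-1)] points, and the others a grid of [k^(N-1)] points.  If a
    nonzero polynomial [f] of degree [d] has multiplicity [m] at the points of a
    grid with [w] values for each coordinate, then [d >= w m] ([grid_degree]).
    So, as long as [d < w m] for the grid in one of the hyperplanes, [f] vanishes
    on this hyperplane, and its equation can be divided out, which lowers by one
    both [d] and the multiplicity at the points of that hyperplane, and leaves
    the others unchanged ([peel_layers]).  The inequalities that hold when no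
    more division is possible imply the bound ([peeled_degree]).  The bound for
    one grid is obtained by the same divisions, by induction on its dimension.

    Multiplicity is measured by the vanishing of partial derivatives
    ([vanishes]).  A form with multiplicity [m] at a point lies in the [m]-th
    power of the ideal of the point by Euler's formula
    ([vanishes_ideal_power]). *)

Set Implicit Arguments.
Unset Strict Implicit.
Unset Printing Implicit Defensive.

Import Order.TTheory GRing.Theory Num.Theory.
Local Open Scope ring_scope.

(** * Preliminaries on multivariate polynomials *)

(** Identities between ring morphisms or derivations need checking on constants
    and variables only. *)
Lemma mpoly_gen_ind (R : comNzRingType) (n : nat) (P : {mpoly R[n]} -> Prop) :
    (forall c, P c%:MP) -> (forall i, P 'X_i) ->
    (forall f g, P f -> P g -> P (f + g)) ->
    (forall f g, P f -> P g -> P (f * g)) ->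
  forall f, P f.
Proof.
move=> PC PX PD PM f; rewrite (mpolyE f).
apply: big_ind => [||m _]; [by rewrite -mpolyC0 | exact: PD |].
rewrite -mul_mpolyC mpolyXE_id; apply: (PM) => //.
apply: big_ind => [||i _]; [by rewrite -mpolyC1 | exact: PM |].
elim: (m i) => [|k IHk]; first by rewrite expr0 -mpolyC1.
by rewrite exprS; apply: (PM).
Qed.

Lemma mnm_subrr (n : nat) (m : 'X_{1..n}) : (m - m)%MM = 0%MM.
Proof. by rewrite -{1}[m]add0m addmK. Qed.

(** * Substituting a constant for a variable *)

Section Substitution.
Variables (K : numFieldType) (n : nat).
Implicit Types (f g h : {mpoly K[n]}) (a : 'I_n -> K) (i j : 'I_n) (s : K).

(** The point [a] moved to the hyperplane [x_j = s]. *)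
Definition upd a j s : 'I_n -> K := fun i => if i == j then s else a i.

Definition subst j s f : {mpoly K[n]} :=
  f \mPo [tuple (if i == j then s%:MP else 'X_i) | i < n].

Lemma substD j s : {morph subst j s : f g / f + g}.
Proof. exact: comp_mpolyD. Qed.

Lemma substM j s : {morph subst j s : f g / f * g}.
Proof. by move=> f g; rewrite /subst rmorphM. Qed.

Lemma substC j s c : subst j s c%:MP = c%:MP.
Proof. exact: comp_mpolyC. Qed.

Lemma substX j s i : subst j s 'X_i = if i == j then s%:MP else 'X_i.
Proof. by rewrite /subst comp_mpolyXU -tnth_nth tnth_mktuple. Qed.

Lemma substXC j s : subst j s ('X_j - s%:MP) = 0.
Proof. by rewrite -mpolyCN substD substX substC eqxx mpolyCN subrr. Qed.

Lemma meval_subst j s f a : (subst j s f).@[a] = f.@[upd a j s].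
Proof.
rewrite comp_mpoly_meval; apply: meval_eq => i.
by rewrite tnth_mktuple /upd; case: ifP; rewrite ?mevalC ?mevalXU.
Qed.

Lemma mderiv_subst j s f i :
  (subst j s f)^`M(i) = if i == j then 0 else subst j s f^`M(i).
Proof.
elim/mpoly_gen_ind: f => [c|k|f g Hf Hg|f g Hf Hg].
- by rewrite substC !mderivC -[0]mpolyC0 substC if_same.
- rewrite substX (fun_if (mderiv i)) mderivC !mderivX mnm1E.
  have [ij|ij] := eqVneq i j; have [kj|kj] := eqVneq k j => //.
  + by rewrite ij (negPf kj) scale0r.
  + by rewrite kj eq_sym (negPf ij) scale0r -[0]mpolyC0 substC.
  case: (eqVneq k i) => [->|_]; last by rewrite !scale0r -[0]mpolyC0 substC.
  by rewrite !scale1r mnm_subrr mpolyX0 -mpolyC1 substC.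
- by rewrite substD mderivD Hf Hg mderivD substD; case: ifP; rewrite ?addr0.
rewrite substM mderivM Hf Hg mderivM substD !substM; case: ifP => //.
by rewrite mul0r mulr0 addr0.
Qed.

Lemma subst_factor j s f : exists h, f = subst j s f + ('X_j - s%:MP) * h.
Proof.
elim/mpoly_gen_ind: f => [c|i|f g [h Hf] [k Hg]|f g [h Hf] [k Hg]].
- by exists 0; rewrite mulr0 addr0 substC.
- rewrite substX; case: eqP => [->|_].
    by exists 1; rewrite mulr1 addrC subrK.
  by exists 0; rewrite mulr0 addr0.
- by exists (h + k); rewrite substD mulrDr addrACA -Hf -Hg.
exists (h * g + subst j s f * k).
move: Hf Hg; rewrite substM.
by move: (subst j s f) (subst j s g) => F G -> ->; ring.
Qed.

Lemma msize_subst j s f : (msize (subst j s f) <= msize f)%N.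
Proof.
rewrite /subst comp_mpolyE; apply: (leq_trans (msize_sum _ _ _)).
apply/bigmax_leqP_seq => m mf _.
apply: leq_trans (_ : mdeg m < _)%N; last exact: msize_mdeg_lt.
set q := \prod_i _.
have -> : q = (s ^+ m j) *: 'X_[m - U_(j) *+ m j].
  rewrite /q (bigD1 j) //= tnth_mktuple eqxx -mul_mpolyC rmorphXn /=.
  congr (_ * _); rewrite mpolyXE_id [RHS](bigD1 j) //= mnmBE mulmnE mnm1E eqxx.
  rewrite mul1n subnn expr0 mul1r; apply: eq_bigr => i ij.
  by rewrite tnth_mktuple (negPf ij) mnmBE mulmnE mnm1E eq_sym (negPf ij) subn0.
do 2 apply: (leq_trans (msizeZ_le _ _)).
by rewrite msizeX ltnS mdegB.
Qed.

Lemma msizeXC j s : msize ('X_j - s%:MP : {mpoly K[n]}) = 2.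
Proof.
apply/eqP; rewrite eqn_leq; apply/andP; split.
  rewrite -mpolyCN (leq_trans (msizeD_le _ _)) // msizeX mdeg1 geq_max /=.
  by rewrite msizeC; case: (_ != _).
have /msize_mdeg_lt : U_(j)%MM \in msupp ('X_j - s%:MP : {mpoly K[n]}).
  by rewrite mcoeff_msupp mcoeffB mcoeffX mcoeffC eqxx mnm1_eq0 mulr0 subr0 oner_eq0.
by rewrite mdeg1.
Qed.

(** A polynomial that vanishes on the hyperplane [x_j = s] is divisible by its
    equation. *)
Lemma subst_eq0_factor j s f : f != 0 -> subst j s f = 0 ->
  exists2 h, f = ('X_j - s%:MP) * h & h != 0 /\ msize f = (msize h).+1.
Proof.
move=> f0 fs0; have [h] := subst_factor j s f; rewrite fs0 add0r => fE.
have h0 : h != 0 by apply: contraNneq f0 => h0; rewrite fE h0 mulr0.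
exists h => //; split=> //; rewrite fE msizeM ?msizeXC //.
by rewrite -msize_poly_eq0 msizeXC.
Qed.

(** * Order of vanishing *)

(** Multiplicity at least [m] at [a], as the vanishing at [a] of all partial
    derivatives of order less than [m].  The recursive form turns most proofs
    into an induction on [m] with the Leibniz rule. *)
Fixpoint vanishes (m : nat) a f : Prop :=
  if m is m'.+1 then f.@[a] = 0 /\ forall i, vanishes m' a f^`M(i) else True.

Lemma vanishesW m a f : vanishes m.+1 a f -> vanishes m a f.
Proof.
elim: m f => // m IHm f [fa0 Hf]; split=> // i; exact: IHm (Hf i).
Qed.

Lemma vanishesD m a f g : vanishes m a f -> vanishes m a g -> vanishes m a (f + g).
Proof.
elim: m f g => // m IHm f g [fa Hf] [ga Hg]; split=> [|i].
  by rewrite mevalD fa ga addr0.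
by rewrite mderivD; exact: IHm (Hf i) (Hg i).
Qed.

Lemma vanishesM m a f g : vanishes m a f -> vanishes m a (g * f).
Proof.
elim: m f g => // m IHm f g Hf; have [fa0 Hdf] := Hf; split=> [|i].
  by rewrite mevalM fa0 mulr0.
rewrite mderivM; apply: vanishesD; apply: IHm; [exact: vanishesW | exact: Hdf].
Qed.

Lemma vanishes0 m a : vanishes m a 0.
Proof. by elim: m => // m IHm; split=> [|i]; rewrite ?meval0 ?mderiv0. Qed.

Lemma vanishes_ext m a b f : a =1 b -> vanishes m a f -> vanishes m b f.
Proof.
move=> ab; elim: m f => // m IHm f [fa0 Hf]; split=> [|i]; last exact: IHm (Hf i).
by rewrite -(meval_eq _ ab).
Qed.

Lemma vanishes_subst m j s f a :
  vanishes m (upd a j s) f -> vanishes m a (subst j s f).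
Proof.
elim: m f => // m IHm f [fa0 Hf]; split=> [|i]; first by rewrite meval_subst.
rewrite mderiv_subst; case: ifP => _; [exact: vanishes0 | exact: IHm (Hf i)].
Qed.

Lemma mderivXC i j s :
  ('X_j - s%:MP : {mpoly K[n]})^`M(i) = (i == j)%:R%:MP.
Proof.
rewrite mderivB mderivC subr0 mderivX mnm1E eq_sym.
case: eqP => [->|_]; last by rewrite scale0r mpolyC0.
by rewrite mnm_subrr mpolyX0 scale1r mpolyC1.
Qed.

(** A factor that does not vanish at the point can be dropped: by the Leibniz
    rule [(X_j - s) h_i] is the derivative of [(X_j - s) h] up to a multiple of
    [h], to which the induction hypothesis applies. *)
Lemma vanishes_factor_off m j s h a : a j != s ->
  vanishes m a (('X_j - s%:MP) * h) -> vanishes m a h.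
Proof.
move=> ajs; elim: m h => // m IHm h Hm; have [ev Hd] := Hm.
have Hh : vanishes m a h by apply: IHm; exact: vanishesW.
split=> [|i].
  move/eqP: ev; rewrite mevalM mevalB mevalXU mevalC mulf_eq0 subr_eq0.
  by rewrite (negPf ajs) => /eqP.
apply: IHm; move: (Hd i); rewrite mderivM => Hi.
have -> : ('X_j - s%:MP) * h^`M(i) =
    (('X_j - s%:MP)^`M(i) * h + ('X_j - s%:MP) * h^`M(i)) +
    (- ('X_j - s%:MP)^`M(i)) * h by ring.
by apply: vanishesD => //; apply: vanishesM.
Qed.

(** Differentiating [(X_j - s) h] along [j] yields [h + (X_j - s) h'], which
    leads to the operators [D_c : h |-> c h + (X_j - s) h'].  A derivative of
    [D_c h] is [D_c] of a derivative of [h], or [D_(c + 1)] of it if the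
    derivative is along [j], and [D_c h] takes the value [c h(a)] at [a]; so [h]
    inherits the order of vanishing of [D_c h], as [c] is never 0 in [K]. *)
Lemma vanishes_euler m j s h a c : a j = s -> (0 < c)%N ->
  vanishes m a (c%:R%:MP * h + ('X_j - s%:MP) * h^`M(j)) -> vanishes m a h.
Proof.
move=> ajs; elim: m c h => // m IHm c h c0 [ev Hd]; split=> [|i].
  move/eqP: ev; rewrite mevalD !mevalM mevalB mevalXU !mevalC ajs subrr mul0r.
  by rewrite addr0 mulf_eq0 pnatr_eq0 eqn0Ngt c0 => /eqP.
move: (Hd i); rewrite mderivD mderiv_mulC mderivM mderivXC addrA.
move=> Hi; apply: (IHm (c + (i == j))%N); first by rewrite addn_gt0 c0.
move: Hi; rewrite mderiv_comm; case: eqP => [->|_]; last first.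
  by rewrite mpolyC0 mul0r addr0 addn0.
by rewrite addn1 -natr1 mpolyCD mpolyC1 [(_ + 1) * _]mulrDl !mul1r.
Qed.

Lemma vanishes_factor_on m j s h a : a j = s ->
  vanishes m.+1 a (('X_j - s%:MP) * h) -> vanishes m a h.
Proof.
move=> ajs [_ /(_ j)]; rewrite mderivM mderivXC eqxx.
exact: (@vanishes_euler _ _ _ _ _ 1%N).
Qed.

End Substitution.

(** * Nonvanishing points *)

Section Nonvanishing.
Variables (K : numFieldType) (n : nat).
Implicit Types (f g h : {mpoly K[n]}) (a b : 'I_n -> K) (i j : 'I_n) (s : K).

(** Each [s] that kills [f] accounts for a linear factor [X_j - s] of [f]. *)
Lemma subst_eq0_finite j f : f != 0 ->
  exists ss : seq K, forall s, subst j s f = 0 -> s \in ss.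
Proof.
have [d] := ubnP (msize f); elim: d f => // d IHd f + f0; rewrite ltnS => fd.
have [[s fs0]|nex] := pselect (exists s, subst j s f = 0); last first.
  by exists [::] => s fs0; case: nex; exists s.
have [h fE [h0 fh]] := subst_eq0_factor f0 fs0.
have [|ss Hss] := IHd h _ h0; first by rewrite -fh.
exists (s :: ss) => s' /eqP; rewrite fE substM -mpolyCN substD substX substC eqxx.
rewrite -mpolyCD mulf_eq0 mpolyC_eq0 subr_eq0 inE.
by case/orP => [->//|/eqP/Hss ->]; rewrite orbT.
Qed.

(** The simultaneous substitution of [b i] for the variables [i] in [l]. *)
Definition substs b (l : seq 'I_n) f := foldr (fun i g => subst i (b i) g) f l.

Lemma substs_all b l f : (forall i, i \in l) -> substs b l f = f.@[b]%:MP.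
Proof.
move=> lT.
have lC c l' : substs b l' c%:MP = c%:MP.
  by elim: l' => //= i l' ->; rewrite substC.
elim/mpoly_gen_ind: f => [c|i|f g Hf Hg|f g Hf Hg].
- by rewrite lC mevalC.
- rewrite mevalXU; have: i \in l by []. 
  elim: l {lT} => //= j l IHl; rewrite inE.
  have [il _|nil] := boolP (i \in l); first by rewrite IHl // substC.
  rewrite orbF => /eqP <-.
  have -> : substs b l 'X_i = 'X_i.
    elim: l nil {IHl} => //= k l IHl; rewrite inE negb_or => /andP[ik nil].
    by rewrite IHl // substX (negPf ik).
  by rewrite substX eqxx.
- rewrite mevalD mpolyCD -Hf -Hg.
  by elim: (l) => //= i l' ->; rewrite substD.
rewrite mevalM mpolyCM -Hf -Hg.
by elim: (l) => //= i l' ->; rewrite substM.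
Qed.

(** A family of nonzero polynomials has a common point of nonvanishing as soon
    as constants can be substituted for one variable at a time without killing
    a member of such a family. *)
Lemma common_nonvanishing (I : Type) (F : I -> {mpoly K[n]}) :
    (forall (G : I -> {mpoly K[n]}) j, (forall x, G x != 0) ->
       exists s, forall x, subst j s (G x) != 0) ->
    (forall x, F x != 0) -> exists a, forall x, (F x).@[a] != 0.
Proof.
move=> substP F0.
suff [b Hb] : exists b, forall x, substs b (enum 'I_n) (F x) != 0.
  exists b => x; move: (Hb x); rewrite substs_all; last by move=> j; rewrite mem_enum.
  by rewrite mpolyC_eq0.
elim: (enum 'I_n) (enum_uniq 'I_n) => [_|j l IHl /= /andP[jl ul]].
  by exists (fun=> 0).
have [b Hb] := IHl ul; have [s Hs] := substP _ j Hb.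
exists (upd b j s) => x; rewrite /upd eqxx.
suff -> : substs (upd b j s) l (F x) = substs b l (F x) by exact: Hs.
elim: l jl {IHl ul Hb Hs} => //= v l IHl; rewrite inE negb_or => /andP[jv jl].
by rewrite IHl // /upd eq_sym (negPf jv).
Qed.

Lemma subst_neq0 f j : f != 0 -> exists2 s, s != 0 & subst j s f != 0.
Proof.
move=> f0; have [ss Hss] := subst_eq0_finite j f0.
pose ns := [seq x.+1%:R : K | x <- iota 0 (size ss).+1].
have uns : uniq ns.
  by rewrite map_inj_uniq ?iota_uniq // => x y /eqP; rewrite eqr_nat eqSS => /eqP.
have /allPn[s /mapP[x _ sE] sss] : ~~ all (mem ss) ns.
  apply/negP => /allP /(uniq_leq_size uns).
  by rewrite size_map size_iota ltnn.
exists s; first by rewrite sE pnatr_eq0.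
by apply: contraNneq sss; exact: Hss.
Qed.

Lemma nonvanishing f : f != 0 -> exists a, f.@[a] != 0.
Proof.
move=> f0; have [|//|a Ha] := @common_nonvanishing unit (fun=> f).
  by move=> G j G0; have [s _ Hs] := subst_neq0 j (G0 tt); exists s => -[].
by exists a; apply: Ha tt.
Qed.

End Nonvanishing.

(** * Splitting off hyperplanes *)

Section Layers.
Variables (K : numFieldType) (n : nat).
Implicit Types (f g h : {mpoly K[n]}) (a b : 'I_n -> K) (i j : 'I_n).

(** The layer [t] is the hyperplane [x_j = c t] with the points of [Z t], on
    which polynomials satisfy the degree bound [w t * m].  Whenever [f] violates
    the bound of some layer, so does its restriction to the hyperplane, which is
    therefore 0; dividing by [X_j - c t] lowers the degree of [f] and the order
    [mu t] by one.  The orders left at the end are [nu], the degree left is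
    [e]. *)
Lemma peel_layers j (q : nat) (c : 'I_q -> K) (Z : 'I_q -> ('I_n -> K) -> Prop)
    (w : 'I_q -> nat) :
    injective c ->
    (forall t m g, g != 0 -> (forall a, Z t a -> vanishes m a g) ->
       (w t * m <= (msize g).-1)%N) ->
  forall f (mu : 'I_q -> nat), f != 0 ->
    (forall t a, Z t a -> vanishes (mu t) (upd a j (c t)) f) ->
  exists (nu : 'I_q -> nat) (e : nat),
    [/\ forall t, (nu t <= mu t)%N, forall t, (w t * nu t <= e)%N
      & (msize f).-1 = (e + \sum_t (mu t - nu t))%N].
Proof.
move=> cI Hw f; have [d] := ubnP (msize f); elim: d f => // d IHd f + mu f0 Hmu.
rewrite ltnS => fd.
have [/forallP wf|] := boolP [forall t, w t * mu t <= (msize f).-1]%N.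
  exists mu, (msize f).-1; split=> //.
  by rewrite big1 ?addn0 // => t _; rewrite subnn.
rewrite negb_forall => /existsP[t]; rewrite -ltnNge => ft.
have fs0 : subst j (c t) f = 0.
  apply/eqP; apply: contraTT ft => fs0; rewrite -leqNgt.
  apply: leq_trans (Hw t (mu t) _ fs0 _) _.
    by move=> a Za; apply/vanishes_subst/Hmu.
  by have := msize_subst j (c t) f; lia.
have [h fE [h0 fh]] := subst_eq0_factor f0 fs0.
have mut : (0 < mu t)%N by case: (mu t) ft => //; rewrite muln0.
have [|| nu [e [nu_le w_nu hE]]] := IHd h _ (fun u => mu u - (u == t))%N h0.
- by rewrite -fh.
- move=> u a Za; have := Hmu u a Za; rewrite fE.
  have [->|ut] := eqVneq u t.
    rewrite -{1}(subnK mut) addn1; apply: vanishes_factor_on.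
    by rewrite /upd eqxx.
  rewrite subn0; apply: vanishes_factor_off.
  by rewrite /upd eqxx (inj_eq cI).
exists nu, e; split=> // [u|]; first exact: leq_trans (nu_le u) (leq_subr _ _).
have -> : (msize f).-1 = (msize h).-1.+1.
  by rewrite fh prednK // lt0n msize_poly_eq0.
rewrite hE -addnS; congr (_ + _)%N.
rewrite [RHS](eq_bigr (fun u => mu u - (u == t) - nu u + (u == t))%N) => [|u _].
  rewrite big_split /= -addn1; congr (_ + _)%N.
  by rewrite (bigD1 t) //= eqxx big1 ?addn0 // => u /negPf ->.
by have := nu_le u; have [->|_] := eqVneq u t; lia.
Qed.

(** Points are constrained only in the coordinates of [l], which allows the
    induction on [l]: a grid is layered by the values of one coordinate, each
    layer being a grid of smaller dimension.  When the peeling ends, every layer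
    has order [nu t] with [size S * nu t <= e]; summed over the [size S] layers,
    this gives [\sum_t nu t <= e]. *)
Lemma grid_degree (S : seq K) (l : seq 'I_n) m f : uniq S -> f != 0 ->
    (forall a, (forall i, i \in l -> a i \in S) -> vanishes m a f) ->
  (size S * m <= (msize f).-1)%N.
Proof.
move=> uS; elim: l m f => [|j l IHl] m f f0 Hf.
  case: m Hf => [|m] Hf; first by rewrite muln0.
  have [a] := nonvanishing f0; have [|-> _] := Hf a; first by [].
  by rewrite eqxx.
have [|||nu [e [nu_le w_nu ->]]] := @peel_layers j (size S) (fun t => S`_t)
  (fun _ a => forall i, i \in l -> a i \in S) (fun=> size S) _ _ f (fun=> m) f0.
- by move=> t u /eqP; rewrite nth_uniq // => /eqP/val_inj.
- by move=> _ m' g g0; apply: IHl.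
- move=> t a Sa; apply: Hf => i; rewrite inE /upd.
  by case: eqP => [_ _|_ /Sa //]; rewrite mem_nth.
have -> : (size S * m = \sum_(t < size S) nu t + \sum_(t < size S) (m - nu t))%N.
  rewrite -big_split /= (eq_bigr (fun=> m)) ?sum_nat_const ?card_ord // => t _.
  by rewrite subnKC.
rewrite leq_add2r; have [S0|S0] := posnP (size S).
  by rewrite big1 // => t; have := ltn_ord t; rewrite {2}S0.
rewrite -(leq_pmul2l S0) big_distrr /=.
apply: leq_trans (leq_sum _ (fun t _ => w_nu t)) _.
by rewrite sum_nat_const card_ord.
Qed.

Lemma sum_ord_if_lt (p q A B : nat) : (p <= q)%N ->
  (\sum_(t < q) (if t < p then A else B) = p * A + (q - p) * B)%N.
Proof.
move=> /subnKC <-; rewrite addKn big_split_ord /=; congr (_ + _)%N.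
  by rewrite (eq_bigr (fun=> A)) ?sum_nat_const ?card_ord // => t _; rewrite ltn_ord.
rewrite (eq_bigr (fun=> B)) ?sum_nat_const ?card_ord // => t _.
by rewrite ltnNge leq_addr.
Qed.

(** With [d = e + \sum_t (m - nu t)], suppose first that [e >= k m].  Bounding
    [m - nu t] below by [m - e / (k + 1)] for the first [s] layers and by 0 for
    the others gives [d >= s m + e (k + 1 - s) / (k + 1)], which increases with
    [e] and is the claim for [e = k m].  If [e < k m], then also
    [m - nu t >= m - e / k] for the other layers, and the resulting bound for
    [d] decreases with [e] and is again the claim for [e = k m]. *)
Lemma peeled_degree (k s m e : nat) (nu : 'I_k.+1 -> nat) : (0 < k)%N -> (s <= k)%N ->
    (forall t, nu t <= m)%N ->
    (forall t : 'I_k.+1, (if t < s then k.+1 else k) * nu t <= e)%N ->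
  (m * (k * k.+1 + s) <= (e + \sum_t (m - nu t)) * k.+1)%N.
Proof.
move=> k0 sk nu_le w_nu.
have [ke|ek] := leqP (k * m) e.
  have : (\sum_(t < k.+1) (if t < s then k.+1 * m - e else 0)
          <= \sum_t k.+1 * (m - nu t))%N.
    by apply: leq_sum => t _; have := w_nu t; case: ifP; nia.
  rewrite -big_distrr sum_ord_if_lt /=; last exact: leqW.
  have [d dE] : exists d, k.+1 = (d + s)%N by exists (k.+1 - s)%N; lia.
  have := leq_mul (leqnn d) ke; have := congr1 (fun x => e * x)%N dE.
  have := congr1 (fun x => k * m * x)%N dE.
  have : (s * (k.+1 * m) <= s * (k.+1 * m - e) + s * e)%N.
    by rewrite -mulnDr leq_mul2l; lia.
  move: (\sum_t _)%N => X; lia.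
have : (\sum_(t < k.+1) (if t < s then k * (k.+1 * m - e) else k.+1 * (k * m - e))
        <= \sum_t (k * k.+1) * (m - nu t))%N.
  apply: leq_sum => t _; have := w_nu t; case: ifP => _ Hw.
    have {}Hw : (k.+1 * m - e <= k.+1 * (m - nu t))%N by nia.
    by rewrite -mulnA leq_mul.
  have {}Hw : (k * m - e <= k * (m - nu t))%N by nia.
  by rewrite [(k * k.+1)%N]mulnC -mulnA leq_mul.
rewrite -big_distrr sum_ord_if_lt /=; last exact: leqW.
move: (\sum_t _)%N => X HX; rewrite -(leq_pmul2l k0).
have [d dE] : exists d, k.+1 = (d + s)%N by exists (k.+1 - s)%N; lia.
have dkm : (d * e <= d * (k * m))%N by rewrite leq_mul2l ltnW ?orbT.
have dE' : (k.+1 - s = d)%N by lia.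
have [A AE] : exists A, (A + e = k.+1 * m)%N by exists (k.+1 * m - e)%N; nia.
have [B BE] : exists B, (B + e = k * m)%N by exists (k * m - e)%N; lia.
have AE' : (k.+1 * m - e = A)%N by lia.
have BE' : (k * m - e = B)%N by lia.
rewrite dE' AE' BE' in HX.
have := congr1 (fun x => s * (k * x))%N AE.
have := congr1 (fun x => d * (k.+1 * x))%N BE.
have := congr1 (fun x => k * e * x)%N dE.
have := congr1 (fun x => k * m * x)%N dE.
have := congr1 (fun x => k * k.+1 * m * x)%N dE.
lia.
Qed.

(** The scale [c] is the value given to the homogenizing coordinate. *)
Lemma layered_grid_degree (j : 'I_n) (l : seq 'I_n) (k s m : nat) (c : K) f :
    c != 0 -> (0 < k)%N -> (s <= k)%N -> f != 0 ->
    (forall (t : 'I_k.+1) a,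
       (forall i, i \in l ->
          exists2 x : nat, (x < if t < s then k.+1 else k)%N & a i = c * x%:R) ->
       vanishes m (upd a j (c * t%:R)) f) ->
  (m * (k * k.+1 + s) <= (msize f).-1 * k.+1)%N.
Proof.
move=> c0 k0 sk f0 Hf.
pose S (t : 'I_k.+1) := [seq c * x%:R | x <- iota 0 (if (t < s)%N then k.+1 else k)].
have cI : injective (fun x : nat => c * x%:R).
  by move=> x y /(mulfI c0) /eqP; rewrite eqr_nat => /eqP.
have [|||nu [e [nu_le w_nu ->]]] := @peel_layers j k.+1 (fun t => c * t%:R)
  (fun t a => forall i, i \in l -> a i \in S t)
  (fun t => if (t < s)%N then k.+1 else k) _ _ f (fun=> m) f0.
- by move=> t u /cI /val_inj.
- move=> t m' g g0 Hg.
  have <- : size (S t) = (if t < s then k.+1 else k)%N by rewrite size_map size_iota.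
  by apply: grid_degree g0 Hg; rewrite map_inj_uniq ?iota_uniq.
- move=> t a Sa; apply: Hf => i /Sa /mapP[x]; rewrite mem_iota add0n => /andP[_ xk] ->.
  by exists x.
exact: peeled_degree.
Qed.

End Layers.

(** * Powers of the ideal of a point *)

Section IdealPower.
Variables (A : comNzRingType) (J : set A).

Lemma ideal_powerD m f g :
  ideal_power J m f -> ideal_power J m g -> ideal_power J m (f + g).
Proof.
move=> [n1 [g1 [h1 [J1 ->]]]] [n2 [g2 [h2 [J2 ->]]]].
exists (n1 + n2)%N.
exists (fun i => match split i with inl i => g1 i | inr i => g2 i end).
exists (fun i => match split i with inl i => h1 i | inr i => h2 i end).
split=> [i j|]; first by case: (split i) => i'; [exact: J1 | exact: J2].
rewrite big_split_ord /=; congr (_ + _); apply: eq_bigr => i _.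
  by rewrite (unsplitK (inl _ i)).
by rewrite (unsplitK (inr _ i)).
Qed.

Lemma ideal_powerM m f g : ideal_power J m f -> ideal_power J m (g * f).
Proof.
move=> [n [g1 [h [Jh ->]]]]; exists n, (fun i => g * g1 i), h; split=> //.
by rewrite big_distrr; apply: eq_bigr => i _ /=; rewrite mulrA.
Qed.

Lemma ideal_power0 m : ideal_power J m 0.
Proof.
exists 0%N, (fun=> 0), (fun _ _ => 0); split=> [[]//|].
by rewrite big_ord0.
Qed.

Lemma ideal_power_exp0 f : ideal_power J 0 f.
Proof.
exists 1%N, (fun=> f), (fun _ _ => 0); split=> [i []//|].
by rewrite big_ord1 big_ord0 mulr1.
Qed.

Lemma ideal_powerS m h f : J h -> ideal_power J m f -> ideal_power J m.+1 (h * f).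
Proof.
move=> Jh [n [g [h1 [Jh1 ->]]]].
exists n, g, (fun i j => if unlift ord0 j is Some j' then h1 i j' else h).
split=> [i j|]; first by case: unliftP => [j'|] _.
rewrite big_distrr; apply: eq_bigr => i _ /=.
rewrite big_ord_recl unlift_none mulrCA; congr (_ * (_ * _)).
by apply: eq_bigr => j _; rewrite liftK.
Qed.

Lemma ideal_power_sum m (I : finType) (F : I -> A) :
  (forall i, ideal_power J m (F i)) -> ideal_power J m (\sum_i F i).
Proof.
move=> HF; apply: big_ind => [||i _]; [exact: ideal_power0 | exact: ideal_powerD | exact: HF].
Qed.

End IdealPower.

Section PointIdeal.
Variables (K : numFieldType) (N : nat).
Implicit Types (P : proj K N) (v : 'rV[K]_N.+1) (f g h : {mpoly K[N.+1]}).

Lemma vanishes_prod (a : 'I_N.+1 -> K) m (h : 'I_m -> {mpoly K[N.+1]}) :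
  (forall j, (h j).@[a] = 0) -> vanishes m a (\prod_j h j).
Proof.
have vM f g k : f.@[a] = 0 -> vanishes k a g -> vanishes k.+1 a (f * g).
  move=> fa0; elim: k g => [|k IHk] g Hg; split; first 1 last.
  - by [].
  - by rewrite mevalM fa0 mul0r.
  - move=> i; rewrite mderivM; apply: vanishesD; first exact: vanishesM.
    by have [_ /(_ i)] := Hg; apply: IHk.
  - by rewrite mevalM fa0 mul0r.
elim: m h => // m IHm h ha0; rewrite big_ord_recl; apply: vM => //.
exact: IHm.
Qed.

Lemma ideal_power_vanishes P m f v :
  ideal_power (point_ideal P) m f -> v \in line P -> vanishes m (v 0) f.
Proof.
move=> [n [g [h [Jh ->]]]] vP.
elim/big_ind: _ => [||i _]; [exact: vanishes0 | exact: vanishesD |].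
by apply: vanishesM; apply: vanishes_prod => j; apply: Jh.
Qed.

Lemma line_span P v : v \in line P -> v != 0 -> line P = <[v]>%VS.
Proof.
move=> vP v0; apply/esym/eqP; rewrite eqEdim dim_vline v0 -memvE vP.
by have /eqP -> := svalP P.
Qed.

Lemma euler_homog d f : f \is d.-homog -> \sum_i 'X_i * f^`M(i) = d%:R *: f.
Proof.
move=> fd; rewrite {2}(mpolyE f) scaler_sumr.
rewrite (eq_bigr (fun i => \sum_(m <- msupp f) f@_m *: ('X_i * 'X_[m]^`M(i)))); last first.
  move=> i _; rewrite {1}(mpolyE f) raddf_sum mulr_sumr; apply: eq_bigr => m _.
  by rewrite /= mderivZ scalerAr.
rewrite exchange_big /= [LHS]big_seq [RHS]big_seq; apply: eq_bigr => m mf.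
rewrite -scaler_sumr scalerA mulrC -scalerA; congr (_ *: _).
have <- : mdeg m = d by exact: dhomog_mf fd _ mf.
rewrite mdegE natr_sum scaler_suml; apply: eq_bigr => i _.
rewrite mderivX -scalerAr -mpolyXD; have [->|mi0] := eqVneq (m i) 0%N.
  by rewrite !scale0r.
by rewrite addmC submK // lep1mP.
Qed.

Lemma mderiv_homog d f i : f \is d.-homog -> f^`M(i) \is d.-1.-homog.
Proof.
move=> fd; apply/dhomogP => m; rewrite mcoeff_msupp mcoeff_mderiv => Hm.
have : (m + U_(i))%MM \in msupp f.
  by rewrite mcoeff_msupp; apply: contraNneq Hm => ->; rewrite mul0rn.
by move/(dhomog_mf fd); rewrite /= mdegD mdeg1 addn1 => <-.
Qed.

(** By Euler's formula the derivative of [f] in the direction of [v] takes at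
    [v] the value [d f(v)]; this applies as well to the partial derivatives of
    [f], which are homogeneous and commute with it. *)
Lemma vanishes_radial d f m v : f \is d.-homog -> vanishes m (v 0) f ->
  vanishes m (v 0) (\sum_i v 0 i *: f^`M(i)).
Proof.
elim: m d f => // m IHm d f fd [fv0 Hf]; split=> [|k].
  transitivity ((\sum_i 'X_i * f^`M(i)).@[v 0]).
    rewrite !raddf_sum; apply: eq_bigr => i _ /=.
    by rewrite mevalZ mevalM mevalXU.
  by rewrite (euler_homog fd) mevalZ fv0 mulr0.
have -> : (\sum_i v 0 i *: f^`M(i))^`M(k) = \sum_i v 0 i *: (f^`M(k))^`M(i).
  by rewrite raddf_sum; apply: eq_bigr => i _; rewrite /= mderivZ mderiv_comm.
exact: IHm (mderiv_homog k fd) (Hf k).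
Qed.

Lemma linear_form_point_ideal P v i j : v \in line P -> v 0 j != 0 ->
  point_ideal P ('X_i - (v 0 i / v 0 j) *: 'X_j).
Proof.
move=> vP vj0 u; rewrite (line_span vP); last first.
  by apply: contraNneq vj0 => ->; rewrite mxE.
by case/vlineP => c ->; rewrite mevalB mevalZ !mevalXU !mxE; field.
Qed.

(** The converse of [ideal_power_vanishes] for forms.  Euler's formula reads
    [d f = \sum_i X_i f_i = \sum_i l_i f_i + (X_j / v_j) \sum_i v_i f_i], where
    [f_i] are the partial derivatives and [l_i = X_i - (v_i / v_j) X_j] is in
    the ideal of the point.  The [f_i] vanish to order one less, and the last
    sum, the derivative of [f] in the direction of [v], vanishes to the same
    order as [f] and has smaller degree. *)
Lemma vanishes_ideal_power P m d f v : v \in line P -> v != 0 ->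
  f \is d.-homog -> vanishes m (v 0) f -> ideal_power (point_ideal P) m f.
Proof.
move=> vP v0; have [j vj0] := rV0Pn _ v0.
elim: m d f => [|m IHm] d f; first by move=> _ _; exact: ideal_power_exp0.
elim: d f => [|d IHd] f fd Hf.
  suff -> : f = 0 by exact: ideal_power0.
  have fC : f = (f@_0)%:MP.
    apply: msize1_polyC; rewrite msizeE; apply/bigmax_leqP_seq => M Mf _.
    by have /= -> := dhomog_mf fd Mf.
  by case: Hf; rewrite fC mevalC => ->; rewrite mpolyC0.
have fE : f = (d.+1%:R^-1)%:MP * (\sum_i ('X_i - (v 0 i / v 0 j) *: 'X_j) * f^`M(i)
                + ((v 0 j)^-1 *: 'X_j) * \sum_i v 0 i *: f^`M(i)).
  rewrite mul_mpolyC mulr_sumr -big_split /=.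
  rewrite (eq_bigr (fun i => 'X_i * f^`M(i))) => [|i _].
    by rewrite (euler_homog fd) scalerA mulVf ?scale1r // pnatr_eq0.
  rewrite mulrBl -[RHS]addr0 -addrA; congr (_ + _).
  by rewrite -!scalerAl -scalerAr scalerA mulrC addNr.
rewrite fE; apply: ideal_powerM; apply: ideal_powerD.
  apply: ideal_power_sum => i; apply: ideal_powerS.
    exact: linear_form_point_ideal.
  by apply: IHm (mderiv_homog i fd) _; case: Hf => _ /(_ i).
apply: ideal_powerM; apply: IHd; last exact: vanishes_radial fd Hf.
by apply: rpred_sum => i _; apply: rpredZ; exact: (mderiv_homog i fd).
Qed.

End PointIdeal.

(** * Closedness of the loci of special position *)

Lemma kernel_minors (F : fieldType) (p q : nat) (B : 'M[F]_(p, q)) :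
  (exists2 c : 'rV_q, c != 0 & c *m B^T = 0) <->
  (forall h : 'I_q -> 'I_p, \det (rowsub h B) = 0).
Proof.
split=> [[c c0 cB] h|H].
  rewrite -det_tr; apply/eqP/det0P; exists c => //.
  apply/rowP => e; have /rowP/(_ (h e)) := cB; rewrite !mxE => cBe.
  by rewrite -[RHS]cBe; apply: eq_bigr => i _; rewrite !mxE.
suff : kermx B^T != 0 by case/rowV0Pn => c /sub_kermxP cB c0; exists c.
rewrite kermx_eq0; apply: contraT; rewrite negbK /row_free mxrank_tr => Bfull.
have := fullrowsub_unit Bfull.
by rewrite unitmxE H unitr0.
Qed.

Section Forms.
Variables (K : numFieldType) (n d : nat).

(** Forms of degree [d] are indexed by their rows of coefficients. *)
Definition deg_monoms : pred 'X_{1..n < d.+1} := [pred M : 'X_{1..n < d.+1} | mdeg M == d].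

Definition monom (i : 'I_#|deg_monoms|) : 'X_{1..n} := bmnm (enum_val i).

Definition form_of (c : 'rV[K]_#|deg_monoms|) : {mpoly K[n]} :=
  \sum_i c 0 i *: 'X_[monom i].

Lemma monom_inj : injective monom.
Proof. by move=> i j /val_inj /enum_val_inj. Qed.

Lemma mdeg_monom i : mdeg (monom i) = d.
Proof. exact/eqP/(enum_valP i). Qed.

Lemma form_of_homog c : form_of c \is d.-homog.
Proof. by apply: rpred_sum => i _; apply: rpredZ; rewrite dhomogX /= mdeg_monom. Qed.

Lemma mcoeff_form_of c i : (form_of c)@_(monom i) = c 0 i.
Proof.
rewrite raddf_sum (bigD1 i) //= mcoeffZ mcoeffX eqxx mulr1 big1 ?addr0 // => j ji.
by rewrite mcoeffZ mcoeffX (inj_eq monom_inj) (negPf ji) mulr0.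
Qed.

Lemma form_of_eq0 c : (form_of c == 0) = (c == 0).
Proof.
apply/eqP/eqP => [c0|->].
  by apply/rowP => i; rewrite -mcoeff_form_of c0 mcoeff0 mxE.
by rewrite /form_of big1 // => i _; rewrite mxE scale0r.
Qed.

Lemma homog_form_of (f : {mpoly K[n]}) : f \is d.-homog ->
  f = form_of (\row_i f@_(monom i)).
Proof.
move=> fd; rewrite -{1}(pihomog_dE fd) (@pihomogwE _ _ _ _ d.+1) /=; last first.
  by rewrite msizeE; apply/bigmax_leqP_seq => m mf _; have /= -> := dhomog_mf fd mf.
rewrite -[LHS]/(\sum_(M in deg_monoms) f@_(bmnm M) *: 'X_[bmnm M]) big_enum_val.
by apply: eq_bigr => i _; rewrite mxE.
Qed.

End Forms.

Arguments deg_monoms : clear implicits.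

Lemma vanishesP (K : numFieldType) (n m : nat) (a : 'I_n -> K) f :
  vanishes m a f <-> forall w : 'X_{1..n}, (mdeg w < m)%N -> f^`M[w].@[a] = 0.
Proof.
elim: m f => [|m IHm] f; first by split.
split=> [[fa0 Hf] w wm|H].
  have [/forallP w0|] := boolP [forall i, w i == 0%N].
    have -> : w = 0%MM by apply/mnmP => i; rewrite mnm0E; apply/eqP.
    by rewrite mderivm0m.
  rewrite negb_forall => /existsP[i wi].
  have wE : w = (U_(i) + (w - U_(i)))%MM by rewrite addmC submK // lep1mP.
  rewrite wE mderivmDm mderivmU1m; apply: (IHm _).1 (Hf i) _ _.
  by move: wm; rewrite {1}wE mdegD mdeg1.
split=> [|i]; first by rewrite -(mderivm0m f) H ?mdeg0.
apply/IHm => w wm; rewrite -mderivmU1m -mderivmDm; apply: H.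
by rewrite mdegD mdeg1.
Qed.

Section Blocks.
Variables (K : numFieldType) (r N : nat).

(** The degree in the coordinates of the [i]-th point, as a measure on
    monomials: [multihomogeneous] is homogeneity for each of these. *)
Definition bdeg (i : 'I_r) (m : 'X_{1..r * N.+1}) : nat :=
  (\sum_(j < N.+1) m (mxvec_index i j))%N.

Fact bdeg0 i : bdeg i 0%MM = 0%N.
Proof. by rewrite /bdeg big1 // => j _; rewrite mnm0E. Qed.

Fact bdegD i : {morph bdeg i : m1 m2 / (m1 + m2)%MM >-> (m1 + m2)%N}.
Proof.
by move=> m1 m2; rewrite /bdeg -big_split; apply: eq_bigr => j _; rewrite mnmDE.
Qed.

HB.instance Definition _ i := isMeasure.Build _ (bdeg i) (bdeg0 i) (bdegD i).

(** The polynomial [p] in the coordinates of the [b]-th point. *)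
Definition block (b : 'I_r) (p : {mpoly K[N.+1]}) : {mpoly K[r * N.+1]} :=
  p \mPo [tuple 'X_(mxvec_index b j) | j < N.+1].

Lemma meval_block b p (v : 'M[K]_(r, N.+1)) : (block b p).@[mxvec v 0] = p.@[v b].
Proof.
rewrite comp_mpoly_meval; apply: meval_eq => j.
by rewrite tnth_mktuple mevalXU mxvecE.
Qed.

Lemma dhomog_bigprod (n : nat) (mf : measure n) (I : finType)
    (F : I -> {mpoly K[n]}) (d : I -> nat) :
  (forall i, F i \is (d i).-homog for mf) ->
  \prod_i F i \is (\sum_i d i)%N.-homog for mf.
Proof.
move=> HF; elim/big_rec2: _ => [|i p e _ Hp]; first exact: dhomog1.
exact: dhomogM.
Qed.

Lemma bdeg_var b i j : bdeg i U_(mxvec_index b j)%MM = (b == i).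
Proof.
have mxI (x y : 'I_r * 'I_N.+1) :
    (mxvec_index x.1 x.2 == mxvec_index y.1 y.2) = (x == y).
  apply/eqP/eqP => [|-> //] E.
  case: x y E => [x1 x2] [y1 y2] /= E.
  have := mxvecE (delta_mx y1 y2 : 'M[K]_(r, N.+1)) x1 x2.
  rewrite E mxvecE !mxE !eqxx /=.
  by case: andP => [[/eqP-> /eqP->] //|_ /eqP]; rewrite oner_eq0.
rewrite /bdeg; under eq_bigr => k _ do rewrite mnm1E (mxI (b, j) (i, k)).
rewrite (bigD1 j) //= xpair_eqE eqxx andbT big1 ?addn0 // => k /negPf kj.
by rewrite xpair_eqE [j == k]eq_sym kj andbF.
Qed.

Lemma block_homog b i d p : p \is d.-homog ->
  block b p \is (if b == i then d else 0)%N.-homog for (bdeg i).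
Proof.
move=> pd; rewrite /block comp_mpolyEX big_seq; apply: rpred_sum => m mp.
apply: rpredZ; rewrite comp_mpolyX.
have -> : (if b == i then d else 0)%N = (\sum_j (b == i) * m j)%N.
  rewrite -big_distrr /= -mdegE; have /= -> := dhomog_mf pd mp.
  by case: (b == i); rewrite ?mul1n ?mul0n.
apply: dhomog_bigprod => j; rewrite tnth_mktuple; apply: dhomogMn.
by rewrite dhomogX /= bdeg_var.
Qed.

End Blocks.

Section Closed.
Variables (K : numFieldType) (r N m d : nat).
Implicit Types (P : 'I_r -> proj K N) (v : 'M[K]_(r, N.+1)).

Lemma mderivm_homog n (w : 'X_{1..n}) (f : {mpoly K[n]}) : f \is d.-homog ->
  f^`M[w] \is (d - mdeg w)%N.-homog.
Proof.
move=> fd; apply/dhomogP => M; rewrite mcoeff_msupp mcoeff_mderivm => HM.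
have : (w + M)%MM \in msupp f.
  by rewrite mcoeff_msupp; apply: contraNneq HM; rewrite addmC => ->; rewrite mul0rn.
by move/(dhomog_mf fd); rewrite /= mdegD => <-; rewrite addKn.
Qed.

(** A condition on forms of degree [d]: the vanishing of one derivative, of
    order less than [m], at one of the [r] points. *)
Notation cond := ('I_r * 'X_{1..N.+1 < m})%type.

Definition cond_at (e : 'I_#|{: cond}|) : cond := enum_val e.

(** It sends the coefficients of a form of degree [d] to the values that must
    vanish for the form to have multiplicity [m] at the rows of [v]. *)
Definition vanishing_mx v : 'M[K]_(#|{: cond}|, #|deg_monoms N.+1 d|) :=
  \matrix_(e, i) ('X_[monom i]^`M[(cond_at e).2]).@[v (cond_at e).1].

Definition generic_vanishing_mx :
    'M[{mpoly K[r * N.+1]}]_(#|{: cond}|, #|deg_monoms N.+1 d|) :=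
  \matrix_(e, i) block (cond_at e).1 ('X_[monom i]^`M[(cond_at e).2]).

Definition vanishing_minors : set {mpoly K[r * N.+1]} :=
  [set f | exists h, f = \det (rowsub h generic_vanishing_mx)].

Lemma meval_minor h v :
  (\det (rowsub h generic_vanishing_mx)).@[mxvec v 0] = \det (rowsub h (vanishing_mx v)).
Proof.
rewrite -det_map_mx; congr (\det _); apply/matrixP => i j.
by rewrite !mxE /= meval_block.
Qed.

(** The entries of a row of the matrix are forms of one degree in the coordinates
    of one point, so that the terms of a minor all have the same multidegree. *)
Lemma vanishing_minors_multihomogeneous f :
  vanishing_minors f -> multihomogeneous f.
Proof.
move=> [h ->].
pose D (i : 'I_r) := (\sum_e if (cond_at (h e)).1 == i
                             then d - mdeg (cond_at (h e)).2 else 0)%N.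
exists D => M + i; suff /dhomogP H : \det (rowsub h generic_vanishing_mx)
    \is (D i).-homog for (bdeg i) by move/H.
apply: rpred_sum => s _; rewrite mulr_sign; set p := \prod__ _.
suff pD : p \is (D i).-homog for (bdeg i) by case: ifP => _; rewrite ?rpredN.
apply: dhomog_bigprod => e; rewrite !mxE; apply: block_homog.
by apply: mderivm_homog; rewrite dhomogX /= mdeg_monom.
Qed.

Lemma vanishing_mx_kernel v (c : 'rV[K]_#|deg_monoms N.+1 d|) :
  c *m (vanishing_mx v)^T = 0 <-> forall b, vanishes m (v b) (form_of c).
Proof.
have E e : (c *m (vanishing_mx v)^T) 0 e =
    ((form_of c)^`M[(cond_at e).2]).@[v (cond_at e).1].
  rewrite mxE !raddf_sum; apply: eq_bigr => i _ /=.
  by rewrite !mxE mderivmZ mevalZ.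
split=> [/rowP H b|H]; last first.
  apply/rowP => e; rewrite E mxE; apply: (vanishesP _ _ _).1 => //.
  exact: bmdeg.
apply/vanishesP => w wm; pose e := enum_rank ((b, BMultinom wm) : cond).
by have := H e; rewrite E mxE /cond_at enum_rankK.
Qed.

Lemma has_form_kernel P v : (forall b, row b v \in line (P b)) ->
    has_form (symbolic_power (range P) m) d ->
  exists2 c : 'rV[K]_#|deg_monoms N.+1 d|, c != 0 & c *m (vanishing_mx v)^T = 0.
Proof.
move=> vP [f [fZ fd f0]].
exists (\row_i f@_(monom i)); first by rewrite -form_of_eq0 -homog_form_of.
apply/vanishing_mx_kernel => b; rewrite -homog_form_of //.
have rowE : row b v 0 =1 v b by move=> j; rewrite mxE.
apply: vanishes_ext rowE _; apply: (ideal_power_vanishes _ (vP b)).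
by apply: fZ; exists b.
Qed.

Lemma kernel_has_form P v (c : 'rV[K]_#|deg_monoms N.+1 d|) :
    (forall b, row b v \in line (P b)) -> (forall b, row b v != 0) ->
    c != 0 -> c *m (vanishing_mx v)^T = 0 ->
  has_form (symbolic_power (range P) m) d.
Proof.
move=> vP v0 c0 /vanishing_mx_kernel cv.
exists (form_of c); split; last by rewrite form_of_eq0.
  move=> _ [b _ <-]; apply: (vanishes_ideal_power (vP b) (v0 b) (form_of_homog c)).
  by apply: vanishes_ext (cv b) => j; rewrite mxE.
exact: form_of_homog.
Qed.

Lemma coordinates P : exists v : 'M[K]_(r, N.+1),
  (forall b, row b v \in line (P b)) /\ (forall b, row b v != 0).
Proof.
exists (\matrix_b vpick (line (P b))); split=> b; rewrite rowK ?memv_pick //.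
by rewrite vpick0 -dimv_eq0; have /eqP -> := svalP (P b).
Qed.

Lemma has_form_closed :
  zariski_closed [set P : 'I_r -> proj K N | has_form (symbolic_power (range P) m) d].
Proof.
exists vanishing_minors; first exact: vanishing_minors_multihomogeneous.
apply/seteqP; split=> P /= HP.
  move=> _ [h ->] v vP; rewrite meval_minor; apply: (kernel_minors _).1.
  exact: has_form_kernel HP.
have [v [vP v0]] := coordinates P.
have [|c c0 cv] := (kernel_minors (vanishing_mx v)).2; last exact: kernel_has_form cv.
by move=> h; rewrite -meval_minor; apply: HP => //; exists h.
Qed.

End Closed.

(** * Very general points *)

(** Nested intervals: the [n]-th step keeps a part of the current interval that
    avoids [u n]. *)
Lemma real_uncountable (R : realType) (u : nat -> R) : exists x, forall n, x != u n.
Proof.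
pose mid (I : R * R) := (I.1 + I.2) / 2.
pose next (I : R * R) y := if y <= mid I then ((mid I + I.2) / 2, I.2) else (I.1, mid I).
pose I := fix I n := if n is n'.+1 then next (I n') (u n') else (0, 1).
have nextP J y : J.1 < J.2 -> let J' := next J y in
    [/\ J.1 <= J'.1, J'.1 < J'.2, J'.2 <= J.2 & forall x, J'.1 <= x <= J'.2 -> x != y].
  rewrite /next /mid => J12; case: ifP => [yJ|/negbT]; last rewrite -ltNge => yJ.
    split=> /=; try lra; move=> x /andP[x1 x2].
    by rewrite neq_lt; apply/orP; right; lra.
  split=> /=; try lra; move=> x /andP[x1 x2].
  by rewrite neq_lt; apply/orP; left; lra.
have I12 n : (I n).1 < (I n).2.
  by elim: n => [|n IHn] /=; [exact: ltr01 | have [] := nextP _ (u n) IHn].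
have I1 n k : (I n).1 <= (I (n + k)%N).1.
  elim: k => [|k IHk]; first by rewrite addn0.
  by rewrite addnS /=; have [H _ _ _] := nextP _ (u (n + k)%N) (I12 (n + k)%N); apply: le_trans H.
have I2 n k : (I (n + k)%N).2 <= (I n).2.
  elim: k => [|k IHk]; first by rewrite addn0.
  by rewrite addnS /=; have [_ _ H _] := nextP _ (u (n + k)%N) (I12 (n + k)%N); apply: le_trans H _.
have I_le n k : (I n).1 <= (I k).2.
  apply: le_trans (I1 n k) _; apply: le_trans (ltW (I12 _)) _.
  by rewrite addnC; apply: I2.
pose E : set R := range (fun n => (I n).1).
have EI k : ubound E (I k).2 by move=> _ [n _ <-].
exists (sup E) => n; have [_ _ _] := nextP _ (u n) (I12 n); apply.
apply/andP; split.
  by apply: ub_le_sup; [exists (I 0%N).2; exact: EI | exists n.+1].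
by apply: ge_sup; [exists (I 0%N).1, 0%N | exact: (EI n.+1)].
Qed.

Lemma countable_nonvanishing (R : realType) (n : nat) (F : nat -> {mpoly R[i][n]}) :
  (forall x, F x != 0) -> exists a, forall x, (F x).@[a] != 0.
Proof.
apply: common_nonvanishing => G j G0.
have [ss Hss] := choice (fun x => subst_eq0_finite j (G0 x)).
pose u k := if unpickle k is Some (x, y) then (ss x)`_y else 0 : R[i].
have [z Hz] := real_uncountable (fun k => complex.Re (u k)).
exists z%:C%C => x; apply/eqP => /Hss zss.
have := Hz (pickle (x, index z%:C%C (ss x))).
by rewrite /u pickleK nth_index //= eqxx.
Qed.

(** The point with homogeneous coordinates [v]. *)
Definition proj_of (K : fieldType) (N : nat) (v : 'rV[K]_N.+1) (v0 : v != 0) :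
  proj K N.
Proof. by exists <[v]>%VS; rewrite dim_vline v0. Defined.

(** A proper closed subset lies in the zero locus of a nonzero polynomial, so it
    suffices to avoid the zeros of countably many polynomials.  The variables
    [X_(b, 0)] are added to these so that each row of coordinates is nonzero. *)
Lemma very_general_point (R : realType) (r N : nat)
    (V : nat -> set ('I_r -> proj R[i] N)) :
    (forall n, zariski_closed (V n) /\ V n <> setT) ->
  exists P, forall n, ~ V n P.
Proof.
move=> HV.
have HF n : exists f : {mpoly R[i][r * N.+1]}, f != 0 /\
    forall P, V n P -> forall v : 'M_(r, N.+1),
      (forall i, row i v \in line (P i)) -> f.@[mxvec v 0] = 0.
  have [[S _ VE] VT] := HV n.
  have [[f [Sf f0]]|H] := pselect (exists f, S f /\ f != 0).
    by exists f; split=> // P; rewrite VE; apply.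
  case: VT; rewrite VE; apply/seteqP; split=> // P _ f Sf v _.
  have [->|f0] := eqVneq f 0; first by rewrite meval0.
  by case: H; exists f.
have [F FP] := choice HF.
pose H n := F n * \prod_(b < r) 'X_(mxvec_index b ord0).
have H0 n : H n != 0.
  apply: mulf_neq0; first by case: (FP n).
  apply/prodf_neq0 => b _; rewrite -msupp_eq0 msuppX //.
have [a Ha] := countable_nonvanishing H0.
pose v : 'M_(r, N.+1) := vec_mx (\row_i a i).
have vE : mxvec v 0 =1 a by move=> i; rewrite vec_mxK mxE.
have v0 b : row b v != 0.
  apply/eqP => /rowP/(_ ord0); rewrite !mxE => a0.
  have /eqP := Ha 0%N; apply; rewrite mevalM rmorph_prod /= (bigD1 b) //=.
  by rewrite mevalXU a0 mul0r mulr0.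
exists (fun b => proj_of (v0 b)) => n Vn.
have [_ /(_ _ Vn v)] := FP n; rewrite (meval_eq _ vE) => Fa.
have := Ha n; rewrite mevalM Fa ?mul0r ?eqxx // => b.
exact: memv_line.
Qed.

(** * The value at very general points *)

Section VeryGeneralValue.
Variables (R : realType) (N r : nat).
Implicit Types (Z : set (proj R[i] N)) (P : 'I_r -> proj R[i] N).

Lemma waldschmidt_ext Z1 Z2 :
    (forall m d, has_form (symbolic_power Z1 m) d <-> has_form (symbolic_power Z2 m) d) ->
  waldschmidt Z1 = waldschmidt Z2.
Proof.
move=> H; rewrite /waldschmidt; congr inf.
suff E m : alpha (symbolic_power Z1 m) = alpha (symbolic_power Z2 m).
  by apply/seteqP; split=> x [m m0 <-]; exists m; rewrite ?E.
rewrite /alpha; congr xget.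
have /funext E : has_form (symbolic_power Z1 m) =1 has_form (symbolic_power Z2 m).
  by move=> d; apply/propext.
by rewrite E.
Qed.

Definition form_locus m d : set ('I_r -> proj R[i] N) :=
  [set P | has_form (symbolic_power (range P) m) d].

(** The proper ones among the loci [form_locus m d], enumerated by [nat]; the
    empty set fills the remaining indices. *)
Definition special_locus (x : nat) : set ('I_r -> proj R[i] N) :=
  if unpickle x is Some (m, d) then
    if pselect (form_locus m d = setT) then set0 else form_locus m d
  else set0.

Lemma special_locus_closed x :
  zariski_closed (special_locus x) /\ special_locus x <> setT.
Proof.
have closed0 : zariski_closed (set0 : set ('I_r -> proj R[i] N)) /\
    (set0 : set ('I_r -> proj R[i] N)) <> setT.
  split.
    exists [set 1]%classic.
      move=> _ ->; exists (fun=> 0%N) => m; rewrite msupp1 inE => /eqP -> i.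
      by rewrite big1 // => j _; rewrite mnm0E.
    apply/seteqP; split=> P // /(_ 1 erefl 0) H.
    have rows0 b : row b (0 : 'M[R[i]]_(r, N.+1)) \in line (P b) by rewrite row0 mem0v.
    by have /eqP := H rows0; rewrite meval1 oner_eq0.
  have v0 : const_mx 1 != 0 :> 'rV[R[i]]_N.+1.
    by apply/eqP => /rowP/(_ ord0)/eqP; rewrite !mxE oner_eq0.
  by move=> E; have : (setT : set ('I_r -> proj R[i] N)) (fun=> proj_of v0) by []; rewrite -E.
rewrite /special_locus; case: unpickle => [[m d]|] //.
by case: pselect => // nT; split=> //; exact: has_form_closed.
Qed.

Lemma special_locusP P : (forall x, ~ special_locus x P) ->
  forall m d, has_form (symbolic_power (range P) m) d <-> form_locus m d = setT.
Proof.
move=> HP m d; split=> [fP|E]; last by have : setT P by []; rewrite -E.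
by have := HP (pickle (m, d)); rewrite /special_locus pickleK; case: pselect.
Qed.

Lemma very_generally_waldschmidt : exists a : R,
  very_generally (fun P : 'I_r -> proj R[i] N => waldschmidt (range P) = a).
Proof.
have [P0 HP0] := very_general_point special_locus_closed.
exists (waldschmidt (range P0)), special_locus; first exact: special_locus_closed.
move=> P HP; apply: waldschmidt_ext => m d.
have {}HP : forall x, ~ special_locus x P by move=> x Hx; apply: HP; exists x.
by rewrite (special_locusP HP) (special_locusP HP0).
Qed.

(** The product of the [m]-th powers of linear forms through each point.  Such
    forms exist as [N > 0]. *)
Lemma exists_form P m : (0 < N)%N -> exists d, has_form (symbolic_power (range P) m) d.
Proof.
move=> N0; have [v [vP v0]] := coordinates P.
have HL b : exists l : {mpoly R[i][N.+1]},
    [/\ point_ideal (P b) l, l \is 1.-homog & l != 0].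
  have [j vj0] := rV0Pn _ (v0 b).
  have [i ij] : exists i : 'I_N.+1, i != j.
    exists (if j == ord0 then ord_max else ord0); case: ifP => [/eqP->|/negbT].
      by rewrite -val_eqE /= -lt0n.
    by rewrite eq_sym.
  exists ('X_i - (row b v 0 i / row b v 0 j) *: 'X_j); split.
  - exact: linear_form_point_ideal.
  - by apply: rpredB; [|apply: rpredZ]; rewrite dhomogX /= mdeg1.
  apply/eqP => /(congr1 (mcoeff U_(i))) /eqP.
  rewrite mcoeffB mcoeffZ !mcoeffXU eqxx [j == i]eq_sym (negPf ij) mulr0 subr0 mcoeff0.
  by rewrite oner_eq0.
have [L LP] := choice HL.
exists (\sum_(b < r) 1 * m)%N, (\prod_b (L b) ^+ m); split.
- move=> _ [b _ <-]; rewrite (bigD1 b) //= mulrC; apply: ideal_powerM.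
  elim: m => [|m IHm]; first exact: ideal_power_exp0.
  by rewrite exprS; apply: ideal_powerS IHm; have [] := LP b.
- by apply: dhomog_bigprod => b; apply: dhomogMn; have [] := LP b.
by apply/prodf_neq0 => b _; rewrite expf_neq0 //; have [] := LP b.
Qed.

(** Hence [alpha] is a genuine minimum, not its default value 0. *)
Lemma alpha_form P m : (0 < N)%N ->
  has_form (symbolic_power (range P) m) (alpha (symbolic_power (range P) m)).
Proof.
move=> /(exists_form P m) exd; rewrite /alpha.
set A := (X in xget _ X); suff /(xgetPex 0%N)[] : exists d, A d by [].
have exb : exists d, `[< has_form (symbolic_power (range P) m) d >].
  by have [d fd] := exd; exists d; apply/asboolP.
case: (ex_minnP exb) => d /asboolP fd dmin; exists d; split=> // e fe.
by apply: dmin; apply/asboolP.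
Qed.

End VeryGeneralValue.

(** * The special configuration *)

Section Configuration.
Variables (K : numFieldType) (N k s : nat).

Definition layer_size (t : 'I_k.+1) := if (t < s)%N then k.+1 else k.

(** A layer, and a point of the grid in this layer. *)
Definition config : finType := {t : 'I_k.+1 & {ffun 'I_N -> 'I_(layer_size t)}}.

Lemma card_config : (s <= k)%N ->
  #|{: config}| = (s * k.+1 ^ N + (k.+1 - s) * k ^ N)%N.
Proof.
move=> sk; rewrite card_tagged sumnE big_map big_enum /=.
rewrite -sum_ord_if_lt; last exact: leqW.
by apply: eq_bigr => t _; rewrite card_ffun !card_ord /layer_size (fun_if (expn^~ N)).
Qed.

(** Coordinate 0 is the homogenizing one; the last among the others is the number
    of the layer. *)
Definition config_vec (p : config) : 'rV[K]_N.+2 :=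
  \row_i (if unlift ord0 i is Some i1 then
            if unlift ord_max i1 is Some i2 then (tagged p i2)%:R else (tag p)%:R
          else 1).

Lemma config_vec_neq0 p : config_vec p != 0.
Proof.
apply/eqP => /rowP/(_ ord0)/eqP.
by rewrite !mxE unlift_none oner_eq0.
Qed.

(** Homogeneity of [f] is replaced by the multiplicity at all multiples of the
    vectors: setting the coordinate 0 to some [c != 0] that does not kill [f]
    leaves a polynomial with the same multiplicities at the layered grid scaled
    by [c]. *)
Lemma config_degree (f : {mpoly K[N.+2]}) m : (0 < k)%N -> (s <= k)%N -> f != 0 ->
    (forall p (c : K), vanishes m ((c *: config_vec p) 0) f) ->
  (m * (k * k.+1 + s) <= (msize f).-1 * k.+1)%N.
Proof.
move=> k0 sk f0 Hf; have [c c0 fc0] := subst_neq0 ord0 f0.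
apply: leq_trans (_ : (msize (subst ord0 c f)).-1 * k.+1 <= _)%N; last first.
  by rewrite leq_mul2r; have := msize_subst ord0 c f; lia.
apply: (@layered_grid_degree _ _ (lift ord0 ord_max)
  [seq lift ord0 (lift ord_max i) | i <- enum 'I_N] _ _ _ c) => // t a Ha.
have /choice[x Hx] (i : 'I_N) : exists x : 'I_(layer_size t),
    a (lift ord0 (lift ord_max i)) = c * (x : nat)%:R.
  have [|x xlt ->] := Ha (lift ord0 (lift ord_max i)).
    by apply/mapP; exists i; rewrite ?mem_enum.
  by exists (Ordinal (xlt : x < layer_size t)%N).
apply: vanishes_subst.
pose p : config := Tagged (fun t => {ffun 'I_N -> 'I_(layer_size t)}) [ffun i => x i].
apply: vanishes_ext (Hf p c) => i; rewrite !mxE /upd.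
case: unliftP => [i1|] -> /=; last by rewrite ?eqxx mulr1.
case: unliftP => [i2|] -> /=; last by rewrite eqxx.
rewrite ifN; last by rewrite (inj_eq lift_inj) eq_sym neq_lift.
by rewrite ffunE Hx.
Qed.

Lemma config_points r : (0 < s <= k)%N ->
    (s * k.+1 ^ N + (k.+1 - s) * k ^ N <= r)%N ->
  exists P : 'I_r -> proj K N.+1,
    forall p, exists i, line (P i) = <[config_vec p]>%VS.
Proof.
case/andP=> s0 sk cr.
have [p0 _] : exists p0, p0 \in {: config}.
  by apply/card_gt0P; rewrite card_config // addn_gt0 muln_gt0 s0 expn_gt0.
exists (fun i => proj_of (config_vec_neq0 (nth p0 (enum {: config}) i))) => p.
have pr : (enum_rank p < r)%N.
  by apply: leq_trans (ltn_ord _) _; rewrite card_config.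
by exists (Ordinal pr) => /=; rewrite -[nth _ _ _]/(nth p0 (enum config) (enum_rank p)) nth_enum_rank.
Qed.

End Configuration.

Theorem proposition4p4 (R : realType) (N k s r : nat) (hN : (1 <= N)%N)
    (hk : (0 < k)%N) (hs : (1 <= s <= k)%N)
    (hr : (s * (k + 1) ^ (N - 1) + (k + 1 - s) * k ^ (N - 1) <= r)%N) :
  k%:R + s%:R / (k + 1)%:R <= waldschmidt_very_general R N r.
Proof.
rewrite !addn1 in hr *.
have [V VC VP] : very_generally (fun P : 'I_r -> proj R[i] N =>
    waldschmidt (range P) = waldschmidt_very_general R N r).
  exact: (xgetPex 0 (P := [set a : R | very_generally (fun P : 'I_r -> proj R[i] N =>
    waldschmidt (range P) = a)]%classic) (very_generally_waldschmidt R N r)).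
have [P HP] : exists P : 'I_r -> proj R[i] N,
    (forall x, ~ V x P) /\ (forall x, ~ special_locus x P).
  (* one family, the two given ones being interleaved *)
  pose W x := if odd x then V x./2 else special_locus x./2.
  have [|P HP] := @very_general_point R r N W.
    by move=> x; rewrite /W; case: ifP => _; [exact: VC | exact: special_locus_closed].
  exists P; split=> x.
    by have := HP x.*2.+1; rewrite /W /= odd_double uphalf_double.
  by have := HP x.*2; rewrite /W odd_double doubleK.
case: HP => PV PS; rewrite -(VP P); last by case=> x _; exact: PV.
apply: lb_le_inf; first by exists ((alpha (symbolic_power (range P) 1))%:R / 1%:R), 1%N.
move=> _ [m m0 <-]; have := alpha_form P m hN.
(* the degree [d] occurs at a very general tuple, hence at every tuple *)
move: (alpha _) => d /(special_locusP PS) dT.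
case: N hN hr dT {V VC VP P PV PS} => // N _; rewrite subSS subn0 => hr dT.
have [P Pconfig] := config_points R[i] hs hr.
have [f [fZ fd f0]] : form_locus m d P by rewrite dT.
have fdeg : (msize f).-1 = d by rewrite -(dhomog_uniq f0 (dhomog_msize fd) fd).
have : (m * (k * k.+1 + s) <= d * k.+1)%N.
  rewrite -fdeg; apply: (config_degree hk _ f0); first by case/andP: hs.
  move=> p c; have [i Pi] := Pconfig p.
  apply: (@ideal_power_vanishes _ _ (P i)); first by apply: fZ; exists i.
  by rewrite Pi memvZ // memv_line.
rewrite -(ler_nat R) !natrM natrD natrM => H.
have mR : (0 : R) < m%:R by rewrite ltr0n.
have kR : (0 : R) < k.+1%:R by rewrite ltr0n.
rewrite ler_pdivlMr // -(ler_pM2r kR); apply: le_trans H.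
suff -> : (k%:R + s%:R / k.+1%:R) * m%:R * k.+1%:R
        = m%:R * (k%:R * k.+1%:R + s%:R) :> R by [].
by field; rewrite nat1r gt_eqF.
Qed.
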